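(* Let $G$ be a unicyclic graph with $n \ge 4$ vertices and maximum degree $\Delta \ge 3$, let $q=\lfloor \frac{n}{\Delta-1}\rfloor$, and let $f : [1,\infty) \to \mathbb{R}^+$ be a function such that $\log f$ is concave. If $q=1$ or $n=2\Delta-2$, then $$ II_f(G) \ge f(\Delta)\, f(n-\Delta+1)\, f(2)\, f(1)^{n-3}. $$ If $q>1$ and $n\ne 2\Delta-2$, then $$ II_f(G) \ge f(\Delta)^q\, f\big(n-q(\Delta-1)+1\big)\, f(1)^{n-q-1}. $$ Both inequalities are attained (i.e., equality holds in the respective case) if and only if $G \in \mathcal{K}_n^\Delta$.
   Context: All graphs are finite, connected, simple (no loops, no multiple edges) and have at least one edge. A unicyclic graph is a graph containing exactly one cycle. For a vertex $u$ of $G$, $d_u$ denotes its degree. $\mathbb{R}^+$ denotes the positive real numbers. For a function $f:[1,\infty)\to\mathbb{R}^+$, $II_f(G) = \prod_{u\in V(G)} f(d_u)$. For $n\ge 4$, $3\le\Delta\le n-1$ and $q=\lfloor \frac{n}{\Delta-1}\rfloor$, define the $n$-tuple $\mathbf{z}$ as follows. If $q=1$ or $n=2\Delta-2$, then $\mathbf{z}=(\Delta,\,n-\Delta+1,\,2,\,1,\dots,1)$ with $n-3$ entries equal to $1$ at the end. If $q\ge 2$ and $n\ne 2\Delta-2$, then $\mathbf{z}=(z_1,\dots,z_n)$ with $z_j=\Delta$ for $1\le j\le q$, $z_{q+1}=n-q(\Delta-1)+1$, and $z_j=1$ for $q+1<j\le n$. $\mathcal{K}_n^\Delta$ is the set of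 unicyclic graphs with $n$ vertices whose degree sequence (in non-increasing order) is $\mathbf{z}$.
   Formalization: That equality forces G to lie in K_n^Δ is proved only when log f is strictly concave; for merely concave log f it fails (f constant, n=5, Δ=3, a 4-cycle with a pendant vertex). Both inequalities and equality for G in K_n^Δ are proved for all concave log f. *)

(* Defs.v *)
From HB Require Import structures.
From mathcomp Require Import all_boot all_order all_algebra.
From mathcomp Require Import all_classical all_reals all_analysis.

Set Implicit Arguments.
Unset Strict Implicit.
Unset Printing Implicit Defensive.

Import Order.TTheory GRing.Theory Num.Theory.

Local Open Scope ring_scope.
Local Open Scope convex_scope.

Record sgraph := SGraph {
  svertex :> finType;
  sedge : rel svertex;
  sg_sym : symmetric sedge;
  sg_irrefl : irreflexive sedge
}.

Notation "x -- y" := (sedge x y) (at level 30).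

Section Graphs.
Variable G : sgraph.

Definition deg (u : G) : nat := #|[set v : G | u -- v]|.

Definition max_deg : nat := \max_(u : G) deg u.

Definition degree_sequence : seq nat := sort geq [seq deg u | u : G].

Definition connected_graph : Prop := forall x y : G, connect (@sedge G) x y.

Definition cycle_edges (c : seq G) : {set {set G}} :=
  [set [set x; next c x] | x in c].

(* A cycle is the subgraph traced by a closed path through at least three
   pairwise distinct vertices. Representing it by its edge set identifies the
   rotations and the reversals of the same closed path. *)
Definition is_cycle (C : {set {set G}}) : Prop :=
  exists c : seq G, [/\ (2 < size c)%N, ucycle (@sedge G) c & C = cycle_edges c].

Definition unicyclic : Prop :=
  connected_graph /\ exists! C : {set {set G}}, is_cycle C.

End Graphs.

(* The degree sequence of the extremal graphs, meaningful for n >= 4 and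
   3 <= Delta <= n - 1. No subtraction truncates in that range, and q >= 1, so
   the else branch is the case q >= 2, n <> 2 * Delta - 2. *)
Definition zseq (n Delta : nat) : seq nat :=
  let q := (n %/ (Delta - 1))%N in
  if (q == 1)%N || (n == 2 * Delta - 2)%N
  then [:: Delta; (n - Delta + 1)%N; 2%N] ++ nseq (n - 3) 1%N
  else nseq q Delta ++ (n - q * (Delta - 1) + 1)%N :: nseq (n - q - 1) 1%N.

Definition in_K (n Delta : nat) (G : sgraph) : Prop :=
  [/\ #|G| = n, unicyclic G & degree_sequence G = zseq n Delta].

Definition II (R : realType) (f : R -> R) (G : sgraph) : R :=
  \prod_(u : G) f (deg u)%:R.

Definition concave_on (R : realType) (D : set R) (g : R -> R) : Prop :=
  @convex_function R R^o D (fun x => - g x).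

(* Needed for uniqueness of the extremal graphs: if f is constant, then ln f is
   concave and every unicyclic graph attains the bound. *)
Definition strictly_concave_on (R : realType) (D : set R) (g : R -> R) : Prop :=
  forall x y t : R, D x -> D y -> x != y -> 0 < t -> t < 1 ->
    t * g x + (1 - t) * g y < g (t * x + (1 - t) * y).

(* Main.v *)
Require Import Defs.
From HB Require Import structures.
From mathcomp Require Import all_boot all_order all_algebra.
From mathcomp Require Import all_classical all_reals all_analysis.
From mathcomp Require Import zify lra.

(* Fix a spanning tree whose parent map decreases a depth function. Each
   non-tree edge closes a cycle whose other edges all lie in the tree, so distinct
   non-tree edges give distinct cycles, and a unicyclic graph has exactly one
   non-tree edge: its degrees add up to 2n. Hence e_u = d_u - 1 takes values in
   [0, Delta - 1] with total n, and at least three e_u are positive because the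
   cycle has three vertices. With phi(e) = ln f(e + 1) - ln f(1), concave and
   zero at 0, one replaces a pair (a, b) by a more spread out pair of the same
   sum, which never increases the sum of phi. Spreading as far as the cap
   Delta - 1 permits gives the second bound; when n <= 2 (Delta - 1), setting
   aside one entry Delta - 1 and keeping a second and a third positive entry
   gives the first. Under strict concavity every nontrivial replacement is
   strict, which forces the extremal sequence. *)

Set Implicit Arguments.
Unset Strict Implicit.
Unset Printing Implicit Defensive.

Import Order.TTheory GRing.Theory Num.Theory.

(** * Spanning trees and fundamental cycles *)

Lemma next_neq_prev (T : eqType) (c : seq T) (x : T) :
  (2 < size c)%N -> uniq c -> x \in c -> next c x != prev c x.
Proof.
move=> sz uc /rot_to[i s def].
have us : uniq (x :: s) by rewrite -def rot_uniq.
have ss : (2 < size (x :: s))%N by rewrite -def size_rot.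
apply/eqP => npx.
have: next c (next c x) = x by rewrite npx next_prev.
rewrite -!(next_rot i uc) def.
case: s {def} us ss => [|y [|z s]] //=.
rewrite !inE !negb_or !eqxx => /andP[/and3P[xy xz _] _] _.
by rewrite eq_sym (negbTE xy) => /eqP; rewrite eq_sym (negbTE xz).
Qed.

Lemma set2_eq (T : finType) (a b x y : T) :
  [set a; b] = [set x; y] -> (x = a /\ y = b) \/ (x = b /\ y = a).
Proof.
move=> e.
have: b \in [set x; y] by rewrite -e set22.
have: a \in [set x; y] by rewrite -e set21.
have: y \in [set a; b] by rewrite e set22.
have: x \in [set a; b] by rewrite e set21.
rewrite !inE => /pred2P[->|->] /pred2P[->|->]; [| by left | by right |].
  by move=> _ /pred2P[] ->; left.
by move=> /pred2P[] ->; left.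
Qed.

(** Take for [d] the distance from [r], and for [p x] the penultimate vertex of a shortest walk from
    [r] to [x]. *)
Lemma bfs_parent (G : sgraph) (r : G) : connected_graph G ->
  exists (p : G -> G) (d : G -> nat),
    forall x, x != r -> sedge x (p x) /\ (d (p x) < d x)%N.
Proof.
move=> conn.
have hex x : exists k, [exists s : k.-tuple G, path (@sedge G) r s && (last r s == x)].
  have /connectP[s ps ->] := conn r x.
  by exists (size s); apply/existsP; exists (in_tuple s); rewrite ps eqxx.
pose d x := ex_minn (hex x).
(* The boolean implication makes a choice available at every vertex, the root included, so that
   [xchoose] defines a total map. *)
have hp x : exists y, (x != r) ==> (sedge x y && (d y < d x)%N).
  have [->|xr] := eqVneq x r; first by exists r.
  rewrite /= {2}/d; case: ex_minnP => k /existsP[s /andP[ps /eqP ls]] kmin.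
  case/lastP: {s}(tval s) (size_tuple s) ps ls => [|s y] /= sz ps ls.
    by rewrite ls eqxx in xr.
  move: ls; rewrite last_rcons => ?; subst y.
  move: ps; rewrite rcons_path => /andP[ps es].
  exists (last r s); rewrite sg_sym es /=.
  rewrite /d; case: ex_minnP => m _ mmin.
  rewrite -sz size_rcons ltnS; apply: mmin.
  by apply/existsP; exists (in_tuple s); rewrite ps eqxx.
exists (fun x => xchoose (hp x)), d => x xr.
by have /implyP/(_ xr)/andP[] := xchooseP (hp x).
Qed.

Section SpanningTree.
Variables (G : sgraph) (r : G) (p : G -> G) (d : G -> nat).
Hypothesis parentP : forall x, x != r -> sedge x (p x) /\ (d (p x) < d x)%N.

(** The guards are there because [p r] is an arbitrary vertex. *)
Definition tree_edge : rel G :=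
  fun x y => ((x != r) && (p x == y)) || ((y != r) && (p y == x)).

Lemma tree_edge_sym : symmetric tree_edge.
Proof. by move=> x y; rewrite /tree_edge orbC. Qed.

Lemma tree_edge_sub x y : tree_edge x y -> sedge x y.
Proof.
case/orP => /andP[/parentP[h _] /eqP <-] //.
by rewrite sg_sym.
Qed.

Lemma connect_tree x y : connect tree_edge x y.
Proof.
have h z : connect tree_edge z r.
  elim/ltn_ind: {z}(d z) {-2}z (erefl (d z)) => k ih z dz.
  have [->|zr] := eqVneq z r; first exact: connect0.
  have [_ lt] := parentP zr.
  apply: (connect_trans (connect1 _)); last by apply: (ih (d (p z))); rewrite -?dz.
  by rewrite /tree_edge zr eqxx.
by apply: connect_trans (h x) _; rewrite (sym_connect_sym tree_edge_sym) h.
Qed.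

Lemma tree_edge_parent x y : (d y <= d x)%N -> tree_edge x y -> y = p x.
Proof.
move=> le /orP[/andP[_ /eqP ->]//|/andP[/parentP[_ lt] /eqP e]].
by move: lt; rewrite e ltnNge le.
Qed.

(* The deepest vertex of a cycle would otherwise have its parent as both of its
   neighbours on the cycle. *)
Lemma cycle_has_chord (c : seq G) : (2 < size c)%N -> ucycle (@sedge G) c ->
  exists2 x, x \in c & ~~ tree_edge x (next c x).
Proof.
move=> sz /andP[cyc uc].
apply/hasP; rewrite has_predC; apply/negP => /allP tr.
have [x0 x0c] : exists x, x \in c.
  by case: c sz {cyc uc tr} => // a c _; exists a; rewrite mem_head.
case: (arg_maxnP (P := [in c]) d x0c) => x xc xmax.
have t1 : next c x = p x.
  by apply: tree_edge_parent; [apply: xmax; rewrite /= mem_next | apply: tr].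
have t2 : prev c x = p x.
  apply: tree_edge_parent; first by apply: xmax; rewrite /= mem_prev.
  rewrite tree_edge_sym; have := tr (prev c x).
  by rewrite mem_prev next_prev //; apply.
suff : next c x != prev c x by rewrite t1 t2 eqxx.
exact: next_neq_prev.
Qed.

(** Close a simple tree path from [u] to [v] by the arc from [v] to [u]. The last conjunct recovers
    the non-tree edge from the cycle. *)
Lemma fundamental_cycle u v : sedge u v -> ~~ tree_edge u v ->
  exists2 C, is_cycle C & [set u; v] \in C /\
    forall x y, [set x; y] \in C -> tree_edge x y \/ [set x; y] = [set u; v].
Proof.
move=> uv ntr.
have /connectP[s0 ps0 vE] := connect_tree u v.
case: (shortenP ps0) (vE) => s ps us _ {}vE.
pose c := u :: s.
(* A path with one vertex would give [u = v], and one with two vertices would make [u -- v] a tree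
   edge. *)
have szc : (2 < size c)%N.
  rewrite /c; case: s ps vE {us c} => [|a [|b s]] //=.
    by move=> _ e; rewrite e sg_irrefl in uv.
  by rewrite andbT => ua e; rewrite e ua in ntr.
have cc : cycle (fun x y => tree_edge x y || (x == v) && (y == u)) c.
  rewrite /= rcons_path -vE !eqxx orbT andbT.
  by apply: sub_path ps => x y ->.
have cG : ucycle (@sedge G) c.
  rewrite /ucycle us andbT; apply: sub_cycle cc => x y.
  by case/orP => [/tree_edge_sub //|/andP[/eqP -> /eqP ->]]; rewrite sg_sym.
exists (cycle_edges c); first by exists c.
split=> [|x y /imsetP[a ac e]].
  (* The arc of [c] outside the tree can only be the closing one. *)
  have [x xc nt] := cycle_has_chord szc cG.
  apply/imsetP; exists x => //.
  have := next_cycle cc xc; rewrite (negbTE nt) /= => /andP[/eqP xv /eqP ->].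
  by rewrite xv finset.setUC.
have /orP[t|/andP[/eqP av /eqP nu]] := next_cycle cc ac; last first.
  by right; rewrite e nu av finset.setUC.
by left; case: (set2_eq (esym e)) => -[-> ->] //; rewrite tree_edge_sym.
Qed.

(** Arcs towards the parent and arcs towards the child are each indexed by the non-root vertices. An
    arc of both kinds would have each end strictly deeper than the other. *)
Lemma card_tree_arcs :
  #|[set a : G * G | tree_edge a.1 a.2]| = (2 * #|G|.-1)%N.
Proof.
pose A := [set (x, p x) | x in predC1 r].
pose B := [set (p x, x) | x in predC1 r].
have -> : [set a : G * G | tree_edge a.1 a.2] = A :|: B.
  apply/finset.setP => -[x y]; rewrite !inE /tree_edge /=; congr (_ || _).
    apply/andP/imsetP => [[xr /eqP <-]|[z zr [-> ->]]]; first by exists x.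
    by rewrite eqxx.
  apply/andP/imsetP => [[xr /eqP <-]|[z zr [-> ->]]]; first by exists y.
  by rewrite eqxx.
rewrite cardsU disjoint_setI0 ?cards0 ?subn0; last first.
  rewrite -setI_eq0; apply/eqP/finset.setP => -[x y]; rewrite !inE.
  apply/negP => /andP[/imsetP[z zr [-> ->]] /imsetP[w wr [e1 e2]]].
  have [_] := parentP zr; have [_] := parentP wr.
  by rewrite -e1 e2 => h /(ltn_trans h); rewrite ltnn.
rewrite !card_imset; [| by move=> x y [] | by move=> x y []].
by rewrite cardC1; lia.
Qed.

End SpanningTree.

(** * Degrees in a unicyclic graph *)

Lemma sum_deg (G : sgraph) :
  \sum_(u : G) deg u = #|[set a : G * G | sedge a.1 a.2]|.
Proof.
rewrite -sum1dep_card -(pair_big_dep xpredT (@sedge G) (fun _ _ => 1%N)) /=.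
by apply: eq_bigr => u _; rewrite /deg -sum1dep_card.
Qed.

Lemma unicyclic_sum_deg (G : sgraph) :
  unicyclic G -> \sum_(u : G) deg u = (2 * #|G|)%N.
Proof.
move=> [conn [C0 [[c [szc cc _]] uniqC]]].
have [r _] : exists x, x \in c.
  by case: c szc {cc} => // a c _; exists a; rewrite mem_head.
have [p [d pP]] := bfs_parent r conn.
have [u uc ntr] := cycle_has_chord pP szc cc.
set v := next c u in ntr.
have uv : sedge u v by apply: next_cycle uc; case/andP: cc.
have [C Ccyc [uvC _]] := fundamental_cycle pP uv ntr.
rewrite sum_deg -(cardsID [set a : G * G | tree_edge r p a.1 a.2]).
have -> : [set a : G * G | sedge a.1 a.2] :&: [set a | tree_edge r p a.1 a.2]
    = [set a | tree_edge r p a.1 a.2].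
  apply/finset.setP => -[x y]; rewrite !inE /=.
  by case: (boolP (tree_edge r p x y)) => [/(tree_edge_sub pP) ->|]; rewrite ?andbF.
have -> : [set a : G * G | sedge a.1 a.2] :\: [set a | tree_edge r p a.1 a.2]
    = [set (u, v); (v, u)].
  apply/finset.setP => -[x y]; rewrite !inE /=; apply/andP/orP; last first.
    case=> /eqP[-> ->] //; split; last by rewrite sg_sym.
    by rewrite tree_edge_sym.
  (* The fundamental cycles of [x -- y] and [u -- v] coincide by uniqueness, so [u -- v] lies on the
     former, whose only non-tree edge is [x -- y]. *)
  case=> nt xy; have [C' C'cyc [_ C'P]] := fundamental_cycle pP xy nt.
  move: uvC; rewrite -(uniqC _ Ccyc) (uniqC _ C'cyc) => /C'P[t|e].
    by rewrite t in ntr.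
  by case: (set2_eq (esym e)) => -[<- <-]; [left|right].
rewrite (card_tree_arcs pP) cards2 xpair_eqE negb_and.
have -> : u != v by apply: contraTneq uv => <-; rewrite sg_irrefl.
have : (0 < #|G|)%N by apply/card_gt0P; exists r.
by rewrite /=; lia.
Qed.

Lemma connected_deg_gt0 (G : sgraph) (u : G) :
  connected_graph G -> (1 < #|G|)%N -> (0 < deg u)%N.
Proof.
move=> conn /card_gt1P[x [y [_ _ xy]]].
have [v uv] : exists v, u != v.
  by have [e|] := eqVneq u x; [exists y; rewrite e | exists x].
have /connectP[[|w s] /=] := conn u v; first by move=> _ e; rewrite e eqxx in uv.
by case/andP=> uw _ _; apply/card_gt0P; exists w; rewrite inE.
Qed.

(** Each vertex of the cycle has its successor and its predecessor as two distinct neighbours. *)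
Lemma unicyclic_deg_gt1 (G : sgraph) :
  unicyclic G -> (2 < #|[set u : G | (1 < deg u)%N]|)%N.
Proof.
move=> [_ [C [[c [szc /andP[cc uc] _]] _]]].
apply: leq_trans (_ : #|c| <= _)%N; first by rewrite (card_uniqP uc).
apply/subset_leq_card/fintype.subsetP => x xc; rewrite inE.
apply/card_gt1P; exists (next c x), (prev c x).
rewrite !inE (next_cycle cc xc) sg_sym (prev_cycle cc xc) next_neq_prev //.
Qed.


(** * Minimising a concave sum over natural sequences of fixed total *)

Section Concave.
Variables (R : realType) (phi : nat -> R).
Hypothesis phi0 : phi 0 = 0%R.
Hypothesis phi_concave : forall x a b, x <= a -> x <= b ->
  (phi x + phi (a + b - x)%N <= phi a + phi b)%R.

Let strict := forall x a b, x < a -> x < b ->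
  (phi x + phi (a + b - x)%N < phi a + phi b)%R.

Local Notation total s := (\sum_(i <- s) phi i)%R.

(* Absorbing one entry e into the remainder r replaces (e, r) by (0, e + r) if
   this fits under M, and by (M, e + r - M) otherwise. *)
Lemma packing_bound (M : nat) (s : seq nat) : 0 < M -> all (geq M) s ->
  (phi M *+ (sumn s %/ M) + phi (sumn s %% M) <= total s)%R.
Proof.
move=> M0; elim: s => [|e s ih] /=.
  by rewrite div0n mod0n big_nil phi0 mulr0n addr0.
case/andP=> eM /ih {}ih; rewrite big_cons.
move: ih; set m := sumn s.
have rM : m %% M < M by rewrite ltn_mod.
set r := m %% M in rM *; set k := m %/ M.
have em : e + m = k * M + (e + r) by rewrite {1}(divn_eq m M) addnCA.
rewrite em modnMDl divnMDl //.
have [lt|ge] := ltnP (e + r) M.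
  rewrite divn_small // modn_small // addn0.
  have := @phi_concave 0 e r (leq0n _) (leq0n _).
  by rewrite phi0 subn0; lra.
have -> : e + r = M + (e + r - M) by lia.
rewrite divnDl // modnDl divnn M0 divn_small ?modn_small; try lia.
rewrite addn0 addn1 mulrSr.
(* The partner of [e + r - M] is [M]; the side conditions hold because [r < M] and [e <= M]. *)
have := @phi_concave (e + r - M) e r _ _.
have -> : e + r - (e + r - M) = M by lia.
move=> /(_ ltac:(lia) ltac:(lia)).
by lra.
Qed.

(** Spread [a] and [b] until one of them reaches 0 or [M]. This is a strict gain, and
    [packing_bound] applies to the new sequence. *)
Lemma packing_bound_strict (M a b : nat) (s : seq nat) :
  strict -> 0 < a < M -> 0 < b < M -> all (geq M) s ->
  (phi M *+ ((a + b + sumn s) %/ M) + phi ((a + b + sumn s) %% M)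
     < phi a + phi b + total s)%R.
Proof.
move=> sc /andP[a0 aM] /andP[b0 bM] sM.
have [x [y [xyE xM yM lt]]] : exists x y, [/\ x + y = a + b, x <= M, y <= M &
    (phi x + phi y < phi a + phi b)%R].
  have [le|gt] := leqP (a + b) M.
    exists 0, (a + b); split => //.
    by have := sc 0 a b a0 b0; rewrite subn0.
  exists (a + b - M), M; split; try lia.
  have := sc (a + b - M) a b ltac:(lia) ltac:(lia).
  by have -> : a + b - (a + b - M) = M by lia.
have := @packing_bound M (x :: y :: s) ltac:(lia).
rewrite /= xM yM addnA xyE => /(_ sM).
by rewrite !big_cons; lra.
Qed.

(* Equality forbids two entries strictly between 0 and M, and the sum then fixes
   the multiset. *)
Lemma packing_bound_eq (M : nat) (s : seq nat) :
  strict -> 0 < M -> all (geq M) s -> sumn s %/ M < size s ->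
  total s = (phi M *+ (sumn s %/ M) + phi (sumn s %% M))%R ->
  perm_eq s (nseq (sumn s %/ M) M ++
             sumn s %% M :: nseq (size s - sumn s %/ M - 1) 0).
Proof.
move=> sc M0 sM szs eqs.
pose t := [seq x <- s | 0 < x < M].
pose k := count_mem M s; pose l := count_mem 0 s.
have sE : perm_eq s (nseq k M ++ nseq l 0 ++ t).
  apply/permP => P; rewrite !count_cat !count_nseq /t /k /l.
  elim: s sM {eqs szs t k l} => [|x s ih] /=; first by rewrite !muln0.
  case/andP=> xM /ih ->.
  have [->|xM'] := eqVneq x M.
    rewrite ltnn andbF (gtn_eqF M0) /=; nia.
  have [->|x0] := eqVneq x 0; first by move=> /=; nia.
  have -> : 0 < x < M by lia.
  by rewrite /=; lia.
have tE : size t <= 1.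
  case tE : t => [|a [|b t']] //.
  have tM x : x \in t -> 0 < x < M by rewrite mem_filter => /andP[].
  have /tM aM : a \in t by rewrite tE !inE eqxx.
  have /tM bM : b \in t by rewrite tE !inE eqxx orbT.
  have sE' : perm_eq s (a :: b :: (nseq k M ++ nseq l 0 ++ t')).
    rewrite (perm_trans sE) // tE.
    by apply/permP => P; rewrite /= !count_cat /=; lia.
  have := @packing_bound_strict M a b (nseq k M ++ nseq l 0 ++ t') sc aM bM.
  move: (perm_all (geq M) sE'); rewrite sM /= => /esym/and3P[_ _ sM'].
  move/(_ sM'); rewrite -addnA.
  have -> : a + (b + sumn (nseq k M ++ nseq l 0 ++ t')) = sumn s.
    by rewrite (perm_sumn sE').
  by rewrite -eqs (perm_big _ sE') /= !big_cons addrA ltxx.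
have sumE : sumn s = k * M + sumn t.
  by rewrite (perm_sumn sE) !sumn_cat !sumn_nseq mul0n add0n mulnC.
have szE : size s = k + l + size t.
  by rewrite (perm_size sE) !size_cat !size_nseq addnA.
case tE' : t tE sumE szE => [|c [|//]] _ /= sumE szE.
  (* With no intermediate entry the remainder is 0, and one of the zeros of [s] has to stand for it;
     the bound on the quotient ensures that there is one. *)
  move: szs; rewrite sumE addn0 mulnK // modnMl => szs.
  rewrite (perm_trans sE) // tE' cats0 perm_cat2l.
  by have -> : l = (size s - k - 1).+1 by lia.
have cM : c < M.
  have : c \in t by rewrite tE' mem_head.
  by rewrite mem_filter => /andP[/andP[]].
rewrite sumE addn0 divnMDl // modnMDl divn_small // modn_small // addn0.
rewrite (perm_trans sE) // tE' perm_cat2l.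
have -> : l = size s - k - 1 by lia.
by rewrite cats1 perm_rcons.
Qed.

Lemma subadditive_sum (s : seq nat) : (phi (sumn s) <= total s)%R.
Proof.
elim: s => [|a s ih]; first by rewrite big_nil /= phi0.
have := @phi_concave 0 a (sumn s) (leq0n _) (leq0n _).
by rewrite big_cons /= phi0 subn0; lra.
Qed.

(** Subadditivity merges [b] and [s] into one entry; the exchange then lowers one of the two
    remaining entries to 1. *)
Lemma two_positive_bound (a b : nat) (s : seq nat) : 0 < a -> 0 < b ->
  (phi 1 + phi (a + b + sumn s - 1)%N <= phi a + phi b + total s)%R.
Proof.
move=> a0 b0.
have := @phi_concave 1 a (b + sumn s) a0 ltac:(lia).
have := subadditive_sum (b :: s).
by rewrite big_cons /= addnA; lra.
Qed.

(** A positive entry of [s] could be merged into [b] with a strict gain, against the bound, so [s]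
    is all zeros. Then [a] or [b] is 1, since otherwise the exchange down to 1 would be strict. *)
Lemma two_positive_bound_eq (a b : nat) (s : seq nat) : strict ->
  0 < a -> 0 < b ->
  (phi a + phi b + total s = phi 1 + phi (a + b + sumn s - 1)%N)%R ->
  perm_eq (a :: b :: s) (a + b + sumn s - 1 :: 1 :: nseq (size s) 0).
Proof.
move=> sc a0 b0 eqs.
have s0 : all (pred1 0) s.
  apply/allP => x xs /=; rewrite -leqn0 leqNgt; apply/negP => x0.
  have sE := perm_to_rem xs.
  have := @two_positive_bound a (b + x) (rem x s) a0 ltac:(lia).
  have := sc 0 b x b0 x0; rewrite phi0 subn0 add0r.
  move: eqs; rewrite (perm_big _ sE) (perm_sumn sE) /= big_cons.
  by rewrite !addnA; lra.
rewrite {1}(all_pred1P _ _ s0).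
have ss : sumn s = 0 by rewrite (all_pred1P _ _ s0) sumn_nseq.
move: eqs; rewrite ss addn0.
have -> : total s = 0%R.
  by rewrite (all_pred1P _ _ s0) big_nseq phi0 iter_addr_0 mul0rn.
have [->|a1] := eqVneq a 1.
  rewrite (_ : 1 + b - 1 = b); last by lia.
  by move=> _; apply/permP => P /=; lia.
have [->|b1] := eqVneq b 1; first by rewrite addnK perm_refl.
by have := sc 1 a b ltac:(lia) ltac:(lia); lra.
Qed.
End Concave.

(** * Exchange inequalities from real concavity *)

(** With [y = a + b - x], the points [a] and [b] are convex combinations of [x] and [y] with swapped
    weights, so adding the two concavity inequalities makes the weights cancel. *)
Lemma concave_exchange (R : realType) (g : R -> R) (x a b : R) :
  concave_on `[1, +oo[%classic%R g -> (1 <= x)%R -> (x <= a)%R -> (x <= b)%R ->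
  (g x + g (a + b - x) <= g a + g b)%R.
Proof.
move=> gc x1 xa xb.
(* Once [x < a], the denominator [y - x] of the weight is positive. *)
have [ax|ax] := eqVneq a x; first by rewrite ax addrAC subrr add0r.
have xa' : (x < a)%R by rewrite lt_neqAle eq_sym ax.
set y := (a + b - x)%R.
have D (z : R) : (1 <= z)%R -> z \in `[1, +oo[%classic%R by move=> ?; rewrite inE /= in_itv /= andbT.
have t0 : (0 <= (b - x) / (y - x))%R by apply: divr_ge0; rewrite /y; lra.
have t1 : ((b - x) / (y - x) <= 1)%R by rewrite ler_pdivrMr /y; lra.
have yx : (y - x != 0)%R by rewrite /y; apply/eqP; lra.
have Dx : x \in `[1, +oo[%classic%R by apply: D.
have Dy : y \in `[1, +oo[%classic%R by apply: D; rewrite /y; lra.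
have := gc (Itv01 t0 t1) x y Dx Dy; have := gc (Itv01 t0 t1) y x Dy Dx.
set t := ((b - x) / (y - x))%R in t0 t1 *.
have convE (u v : R) : conv (Itv01 t0 t1) (u : convex_lmodType R^o) v
  = (t * u + (1 - t) * v)%R by [].
rewrite !convE !convRE /unstable.onem /=.
have tE : (t * (y - x) = b - x)%R by rewrite /t mulfVK.
have -> : (t * y + (1 - t) * x = b)%R by lra.
have -> : (t * x + (1 - t) * y = a)%R by rewrite /y in tE *; lra.
by lra.
Qed.

Lemma strictly_concave_exchange (R : realType) (g : R -> R) (x a b : R) :
  strictly_concave_on `[1, +oo[%classic%R g ->
  (1 <= x)%R -> (x < a)%R -> (x < b)%R ->
  (g x + g (a + b - x) < g a + g b)%R.
Proof.
move=> gc x1 xa xb.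
set y := (a + b - x)%R.
have D (z : R) : (1 <= z)%R -> `[1, +oo[%classic%R z by move=> ?; rewrite /= in_itv /= andbT.
have t0 : (0 < (b - x) / (y - x))%R by apply: divr_gt0; rewrite /y; lra.
have t1 : ((b - x) / (y - x) < 1)%R by rewrite ltr_pdivrMr /y; lra.
have yx : (y - x != 0)%R by rewrite /y; apply/eqP; lra.
have xy : (x != y)%R by rewrite -subr_eq0 -opprB oppr_eq0.
have Dx := D x x1.
have Dy : `[1, +oo[%classic%R y by apply: D; rewrite /y; lra.
have := gc x y _ Dx Dy xy t0 t1.
have := gc y x _ Dy Dx _ t0 t1; rewrite eq_sym => /(_ xy).
set t := ((b - x) / (y - x))%R.
have tE : (t * (y - x) = b - x)%R by rewrite /t mulfVK.
have -> : (t * y + (1 - t) * x = b)%R by lra.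
have -> : (t * x + (1 - t) * y = a)%R by rewrite /y in tE *; lra.
by lra.
Qed.

(** * The extremal sequence and its minimality *)

(* The extremal sequence in terms of e = d - 1, with M = Delta - 1. *)
Definition zseq_pred (n M : nat) : seq nat :=
  if (n %/ M == 1) || (n == 2 * M)
  then [:: M; n - M - 1; 1] ++ nseq (n - 3) 0
  else nseq (n %/ M) M ++ n %% M :: nseq (n - n %/ M - 1) 0.

Lemma zseqE (n M : nat) : M.+1 < n -> zseq n M.+1 = map S (zseq_pred n M).
Proof.
move=> nM; rewrite /zseq /zseq_pred subn1 /=.
have -> : 2 * M.+1 - 2 = 2 * M by lia.
case: ifP => _.
  by rewrite /= map_nseq; do 2 congr (_ :: _); lia.
rewrite map_cat /= !map_nseq; congr (_ ++ _ :: _).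
by rewrite {1}(divn_eq n M) addKn addn1.
Qed.

Lemma size_zseq_pred (n M : nat) : 1 < M -> 2 < n -> size (zseq_pred n M) = n.
Proof.
move=> M1 n2; rewrite /zseq_pred; case: ifP => _.
  by rewrite /= size_nseq; lia.
rewrite size_cat /= !size_nseq.
have : n %/ M < n by apply: ltn_Pdiv => //; lia.
by lia.
Qed.

Lemma path_geq_nseq (k a : nat) (t : seq nat) :
  path geq a (nseq k a ++ t) = path geq a t.
Proof. by elim: k => //= k ->; rewrite leqnn. Qed.

Lemma path_geq_ones (k a : nat) : 0 < a -> path geq a (nseq k 1).
Proof.
case: k => //= k ->.
by rewrite -[nseq _ _]cats0 path_geq_nseq.
Qed.

Lemma sorted_zseq (n M : nat) : 1 < M -> M.+1 < n -> sorted geq (zseq n M.+1).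
Proof.
(* Prepending one more [M.+1] lets the block of maximal entries be stripped by [path_geq_nseq],
   whatever its length. *)
move=> M1 nM; apply: (@path_sorted _ _ M.+1).
rewrite /zseq subn1 /=; have -> : 2 * M.+1 - 2 = 2 * M by lia.
have dE := divn_eq n M.
have rM : n %% M < M by rewrite ltn_mod; lia.
case: ifP => [c|_].
  rewrite /= leqnn path_geq_ones // andbT.
  (* This puts the second entry below the first; [M.+1 < n] keeps it at least 2, the third entry. *)
  have : n <= 2 * M by case/orP: c => /eqP c; [rewrite c in dE|]; lia.
  by lia.
rewrite path_geq_nseq /= path_geq_ones ?andbT; last by lia.
by rewrite {1}dE addKn addn1 ltnS ltnW.
Qed.

Lemma perm_three_positive (M : nat) (s : seq nat) : 0 < M -> M \in s ->
  2 < count (ltn 0) s ->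
  exists a b t, [/\ perm_eq s [:: M, a, b & t], 0 < a & 0 < b].
Proof.
move=> M0 Ms; have sE := perm_to_rem Ms.
rewrite (permP sE) /= M0 add1n ltnS; set s1 := rem M s in sE * => c.
have /hasP[a a1 a0] : has (ltn 0) s1 by rewrite has_count ltnW.
have s1E := perm_to_rem a1; move: c; rewrite (permP s1E) /= (a0 : 0 < a) add1n ltnS.
rewrite -has_count => /hasP[b b1 b0].
exists a, b, (rem b (rem a s1)); split => //.
rewrite (perm_trans sE) // perm_cons (perm_trans s1E) // perm_cons.
exact: perm_to_rem.
Qed.

(** In the first case one entry [M] is set aside and the two-positive bound is applied to the rest,
    of total [n - M]. The other case is the packing bound. *)
Lemma extremal_bound (R : realType) (phi : nat -> R) (n M : nat) (s : seq nat) :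
  phi 0 = 0%R ->
  (forall x a b, x <= a -> x <= b ->
     (phi x + phi (a + b - x)%N <= phi a + phi b)%R) ->
  1 < M -> size s = n -> sumn s = n -> all (geq M) s -> M \in s ->
  2 < count (ltn 0) s ->
  (\sum_(i <- zseq_pred n M) phi i <= \sum_(i <- s) phi i)%R /\
  ((forall x a b, x < a -> x < b ->
     (phi x + phi (a + b - x)%N < phi a + phi b)%R) ->
   (\sum_(i <- s) phi i = \sum_(i <- zseq_pred n M) phi i)%R ->
   perm_eq s (zseq_pred n M)).
Proof.
move=> phi0 cc M1 szs sums sM Ms c3.
have sum0 k : (\sum_(i <- nseq k 0) phi i = 0)%R.
  by rewrite big_nseq phi0 iter_addr_0 mul0rn.
rewrite /zseq_pred; case: ifP => [_|/norP[nM1 nM2]].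
  have [a [b [t [sE a0 b0]]]] := perm_three_positive (ltnW M1) Ms c3.
  have tE : a + b + sumn t = n - M by rewrite -sums (perm_sumn sE) /=; lia.
  have szt : size t = n - 3 by rewrite -szs (perm_size sE) /=; lia.
  have := two_positive_bound phi0 cc t a0 b0.
  rewrite tE (perm_big _ sE) /= !big_cons sum0 => le; split; first by lra.
  move=> sc e; have /= := @two_positive_bound_eq _ _ phi0 cc a b t sc a0 b0.
  rewrite tE szt => /(_ ltac:(lra)) pE.
  by rewrite (perm_trans sE) // perm_cons.
have M0 : 0 < M by apply: ltnW.
have := packing_bound phi0 cc M0 sM.
rewrite sums big_cat big_nseq /= big_cons sum0 iter_addr_0 addr0 => le.
split=> // sc e.
have := @packing_bound_eq _ _ phi0 cc M s sc M0 sM.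
rewrite sums szs; apply=> //.
(* Since [M > 1], the quotient is below the length [n], as the equality case of packing requires. *)
by apply: ltn_Pdiv => //; rewrite -szs; case: (s) Ms.
Qed.

(** * From sums of logarithms to the product *)

(** Subtracting [ln (f 1)] makes the summand vanish at 0; the correction depends only on the length,
    so it cancels between sequences of equal size. *)
Lemma ln_prod_seq (R : realType) (f : R -> R) (s : seq nat) :
  (forall x : R, 1 <= x -> 0 < f x)%R ->
  (ln (\prod_(e <- s) f e.+1%:R) =
   \sum_(e <- s) (ln (f e.+1%:R) - ln (f 1)) + ln (f 1) *+ size s)%R.
Proof.
move=> f_pos.
have fS e : (0 < f e.+1%:R)%R by apply: f_pos; rewrite ler1n.
elim: s => [|e s ih]; first by rewrite !big_nil ln1 addr0.
rewrite !big_cons lnM ?posrE ?prodr_gt0 // ih /= mulrS; lra.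
Qed.

Lemma II_degree_sequence (R : realType) (f : R -> R) (G : sgraph) :
  II f G = (\prod_(d <- degree_sequence G) f d%:R)%R.
Proof.
by rewrite (perm_big _ (permEl (perm_sort _ _))) big_image.
Qed.

Local Open Scope ring_scope.

Theorem theorem4p10 (R : realType) (G : sgraph) (n Delta q : nat) (f : R -> R)
    (hG : unicyclic G) (hcard : #|G| = n) (hn : (4 <= n)%N)
    (hmax : max_deg G = Delta) (hDelta : (3 <= Delta)%N)
    (hq : q = (n %/ (Delta - 1))%N)
    (f_pos : forall x : R, 1 <= x -> 0 < f x)
    (f_logconcave : concave_on `[1, +oo[%classic (fun x => ln (f x))) :
  let case1 := q = 1%N \/ n = (2 * Delta - 2)%N in
  let case2 := (1 < q)%N /\ n <> (2 * Delta - 2)%N in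
  let bound1 := f Delta%:R * f (n - Delta + 1)%:R * f 2 * f 1 ^+ (n - 3) in
  let bound2 :=
    f Delta%:R ^+ q * f (n - q * (Delta - 1) + 1)%:R * f 1 ^+ (n - q - 1) in
  [/\ (case1 -> bound1 <= II f G),
      (case2 -> bound2 <= II f G),
      (in_K n Delta G ->
        (case1 -> II f G = bound1) /\ (case2 -> II f G = bound2))
    & (strictly_concave_on `[1, +oo[%classic (fun x => ln (f x)) ->
        (case1 -> (II f G = bound1 <-> in_K n Delta G)) /\
        (case2 -> (II f G = bound2 <-> in_K n Delta G)))].
Proof.
move=> case1 case2 bound1 bound2.
(* Both bounds are this single product over the extremal sequence, so the two cases can be treated
   together. *)
pose bz := \prod_(d <- zseq n Delta) f d%:R.
have bz1 : case1 -> bz = bound1.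
  move=> c; rewrite /bz /zseq -hq.
  have -> : (q == 1)%N || (n == 2 * Delta - 2)%N.
    by apply/orP; case: c => /eqP; [left|right].
  by rewrite /= !big_cons big_nseq -Monoid.iteropE /bound1 !mulrA.
have bz2 : case2 -> bz = bound2.
  case=> q1 n2; rewrite /bz /zseq -hq gtn_eqF //= (introF eqP n2).
  by rewrite big_cat big_cons !big_nseq -!Monoid.iteropE /bound2 /= !mulrA.
suff [le inK eqK] : [/\ bz <= II f G, in_K n Delta G -> II f G = bz
    & strictly_concave_on `[1, +oo[%classic (fun x => ln (f x)) ->
      II f G = bz -> in_K n Delta G].
  split=> [/bz1 <-|/bz2 <-|h|sc] //; first by split=> [/bz1 <-|/bz2 <-]; apply: inK.
  by split=> [/bz1 <-|/bz2 <-]; split; [exact: eqK|exact: inK|exact: eqK|exact: inK].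
pose M := Delta.-1; have DE : Delta = M.+1 by rewrite prednK //; lia.
pose s := [seq (deg u).-1 | u : G].
have deg0 (u : G) : (0 < deg u)%N.
  by case: hG => conn _; apply: (connected_deg_gt0 u conn); rewrite hcard; lia.
have sS : map S s = [seq deg u | u : G].
  by rewrite /s -map_comp; apply: eq_map => u /=; rewrite prednK.
have szs : size s = n by rewrite size_map -cardE; exact: hcard.
have sums : sumn s = n.
  have e : \sum_(u : G) deg u = (\sum_(u : G) (deg u).-1 + #|G|)%N.
    by rewrite -sum1_card -big_split; apply: eq_bigr => u _ /=; rewrite addn1 prednK.
  move: e; rewrite unicyclic_sum_deg // hcard => e.
  have -> : sumn s = (\sum_(u : G) (deg u).-1)%N by rewrite sumnE big_image.
  by clear -e; lia.
have sM : all (geq M) s.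
  apply/allP => _ /mapP[u _ ->] /=.
  by rewrite -ltnS prednK // -DE -hmax bigop.leq_bigmax.
have Ms : M \in s.
  have [|u hu] := @bigop.eq_bigmax G (@deg G); first by rewrite hcard; lia.
  apply/mapP; exists u; first by rewrite mem_enum.
  by rewrite -hu -/(max_deg G) hmax.
have c3 : (2 < count (ltn 0) s)%N.
  have := unicyclic_deg_gt1 hG; rewrite cardsE cardE /enum_mem size_filter.
  rewrite /s /image_mem count_map enumT => /leq_trans; apply.
  by apply: sub_count => u /=; rewrite unfold_in /=; case: (deg u) => [|[]].
have M1 : (1 < M)%N by lia.
(* The entry [M] and two further positive entries fit into the total [n], which yields
   [Delta <= n - 1]. *)
have nM : (M.+1 < n)%N.
  have [a [b [t [sE a0 b0]]]] := perm_three_positive (ltnW M1) Ms c3.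
  by rewrite -sums (perm_sumn sE) /=; lia.
pose phi e := ln (f e.+1%:R) - ln (f 1).
have phi0 : phi 0%N = 0 by rewrite /phi subrr.
have exch (x a b : nat) : (x <= a)%N -> (x <= b)%N ->
    (a + b - x).+1%:R = a.+1%:R + b.+1%:R - x.+1%:R :> R.
  by move=> xa xb; rewrite -natrD -natrB; [congr (_%:R)|]; lia.
have [] := @extremal_bound R phi n M s phi0 _ M1 szs sums sM Ms c3.
  move=> x a b xa xb; rewrite /phi exch //.
  have := @concave_exchange _ _ x.+1%:R a.+1%:R b.+1%:R f_logconcave.
  by rewrite ler1n !ler_nat => /(_ isT xa xb) /=; lra.
have zE : zseq n Delta = map S (zseq_pred n M) by rewrite DE zseqE.
have zsz : size (zseq_pred n M) = n.
  by apply: size_zseq_pred => //; lia.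
have bzE : bz = \prod_(e <- zseq_pred n M) f e.+1%:R by rewrite /bz zE big_map.
have IIE : II f G = \prod_(e <- s) f e.+1%:R.
  have -> : II f G = \prod_(d <- [seq deg u | u : G]) f d%:R by rewrite big_image.
  by rewrite -sS big_map.
have P0 (t : seq nat) : \prod_(e <- t) f e.+1%:R \is Num.pos.
  by rewrite posrE prodr_gt0 // => e _; apply: f_pos; rewrite ler1n.
move=> le eqz; split.
- rewrite bzE IIE -ler_ln // !ln_prod_seq // zsz szs; lra.
- by case=> _ _ dz; rewrite II_degree_sequence dz.
(* Both sequences are sorted, so it suffices to match them up to permutation, which is the equality
   case of [extremal_bound]. *)
move=> sc e; split=> //; apply: (@sorted_eq _ geq).
- by move=> y x z /= xy yz; apply: leq_trans yz xy.
- by move=> x y /=; rewrite andbC -eqn_leq => /eqP.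
- by apply: sort_sorted => x y /=; exact: leq_total.
- by rewrite DE sorted_zseq.
rewrite perm_sort -sS zE; apply: perm_map; apply: eqz => [x a b xa xb|].
  rewrite /phi (exch _ _ _ (ltnW xa) (ltnW xb)).
  have := @strictly_concave_exchange _ _ x.+1%:R a.+1%:R b.+1%:R sc.
  by rewrite ler1n !ltr_nat => /(_ isT xa xb) /=; lra.
move: e; rewrite bzE IIE => /(congr1 (@ln R)).
by rewrite !ln_prod_seq // zsz szs => /addIr.
Qed.
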